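(* Let $X\subset\mathbb{E}^3$ be a compact set such that $\mathbf{B}[X]$ is a spindle convex body in $\mathbb{E}^3$. (i) If $0<\mathrm{diam}(X)\le 0.577$, then $I(\mathbf{B}[X])=4$. (ii) If $0.577<\mathrm{diam}(X)\le 0.774$, then $I(\mathbf{B}[X])\le 5$.
   Context: $\mathbb{E}^3$ is $3$-dimensional Euclidean space, $\mathbb{S}^2$ is its unit sphere centered at the origin, and $\mathrm{diam}$ denotes Euclidean diameter. For a compact set $X\subset\mathbb{E}^3$, $\mathbf{B}[X]$ denotes the intersection of the closed unit balls (radius $1$) centered at the points of $X$; it is called a spindle convex body if it has nonempty interior. Illumination number: a direction $\mathbf{v}\in\mathbb{S}^{2}$ illuminates a boundary point $\mathbf{b}$ of a convex body $\mathbf{K}$ (compact convex set with nonempty interior) if the halfline emanating from $\mathbf{b}$ with direction vector $\mathbf{v}$ intersects the interior of $\mathbf{K}$. Directions $\mathbf{v}_1,\dots,\mathbf{v}_n$ illuminate $\mathbf{K}$ if each boundary point of $\mathbf{K}$ is illuminated by at least one of them. $I(\mathbf{K})$ is the smallest $n$ for which there exist $n$ directions that illuminate $\mathbf{K}$. *)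

(* Defs.v *)
From mathcomp Require Import all_boot all_order all_algebra.
From mathcomp Require Import all_classical all_reals all_analysis.
Set Implicit Arguments.
Unset Strict Implicit.
Unset Printing Implicit Defensive.
Import Order.TTheory GRing.Theory Num.Theory.
Import numFieldNormedType.Exports.
Local Open Scope classical_set_scope.
Local Open Scope ring_scope.

(* Euclidean d-space is 'rV[R]_d.  Its canonical topology in the library is
   the one of the max norm, which is the Euclidean topology, so [compact] and
   [interior] are the library's; the canonical norm `|x| is the max norm, so
   all metric notions below go through [enorm] instead. *)
Definition enorm (R : realType) (d : nat) (x : 'rV[R]_d) : R :=
  Num.sqrt (\sum_(i < d) x ord0 i ^+ 2).

Definition unit_sphere (R : realType) (d : nat) : set 'rV[R]_d :=
  [set x | enorm x = 1].

Definition unit_ball (R : realType) (d : nat) (c : 'rV[R]_d) : set 'rV[R]_d :=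
  [set y | enorm (y - c) <= 1].

(* [sup] is a genuine supremum when X is nonempty and bounded; for X empty it
   takes the value 0. *)
Definition diam (R : realType) (d : nat) (X : set 'rV[R]_d) : R :=
  sup [set enorm (p.1 - p.2) | p in X `*` X].

Definition ball_body (R : realType) (d : nat) (X : set 'rV[R]_d) :
    set 'rV[R]_d :=
  \bigcap_(x in X) unit_ball x.

Definition spindle_convex_body (R : realType) (d : nat) (X : set 'rV[R]_d) :
    Prop :=
  (ball_body X)° !=set0.

Definition boundary (R : realType) (d : nat) (K : set 'rV[R]_d) :
    set 'rV[R]_d :=
  closure K `\` K°.

Definition illuminates (R : realType) (d : nat) (K : set 'rV[R]_d)
    (v b : 'rV[R]_d) : Prop :=
  exists2 t : R, 0 <= t & K° (b + t *: v).

Definition illuminated_by (R : realType) (d : nat) (K : set 'rV[R]_d)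
    (n : nat) : Prop :=
  exists2 v : 'I_n -> 'rV[R]_d,
    (forall i, unit_sphere (v i)) &
    (forall b, boundary K b -> exists i, illuminates K (v i) b).

(* Extended-real valued, so that a set illuminated by no finite family of
   directions has illumination number +oo; otherwise the infimum is attained,
   being taken over a nonempty set of natural numbers. *)
Definition illumination_number (R : realType) (d : nat) (K : set 'rV[R]_d) :
    \bar R :=
  ereal_inf [set (n%:R)%:E | n in [set n | illuminated_by K n]].

(* Main.v *)
(* Write K = B[X]. A direction v illuminates a boundary point b of K as soon as
   <v, x - b> > 0 for every x in X at distance 1 from b. If none of finitely many
   directions v_i illuminates b, each i yields a unit vector n_i = x_i - b with
   <v_i, n_i> <= 0, and the n_i are pairwise at distance at most diam X. By Jung's
   theorem on the sphere all n_i lie in a cap whose angular radius has sine at most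
   diam X / sqrt 3; if every unit vector has inner product greater than that sine
   with some v_i, then v_i has positive inner product with the whole cap, a
   contradiction. The vertices of a regular tetrahedron reach inner product 1/3 and
   those of a triangular bipyramid 1 / sqrt 5. Conversely d vectors in dimension d
   lie in a common closed half-space {<w, .> >= 0}, so they fail to illuminate a
   point of K maximising <w, .>. *)

Require Import Defs.
From mathcomp Require Import all_boot all_order all_algebra.
From mathcomp Require Import all_classical all_reals all_analysis.
From mathcomp Require Import ring lra.
Set Implicit Arguments.
Unset Strict Implicit.
Unset Printing Implicit Defensive.
Import Order.TTheory GRing.Theory Num.Theory.
Import numFieldNormedType.Exports.
Local Open Scope classical_set_scope.
Local Open Scope ring_scope.

(** * The Euclidean inner product *)

Definition dot (R : realType) (d : nat) (u v : 'rV[R]_d) : R :=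
  \sum_(i < d) u ord0 i * v ord0 i.

Section Dot.
Context {R : realType} {d : nat}.
Implicit Types (u v w : 'rV[R]_d) (a : R).

Lemma dotC u v : dot u v = dot v u.
Proof. by apply: eq_bigr => i _; rewrite mulrC. Qed.

Lemma dotDl u v w : dot (u + v) w = dot u w + dot v w.
Proof. by rewrite -big_split; apply: eq_bigr => i _; rewrite mxE mulrDl. Qed.

Lemma dotZl a u v : dot (a *: u) v = a * dot u v.
Proof. by rewrite mulr_sumr; apply: eq_bigr => i _; rewrite mxE mulrA. Qed.

Lemma dotNl u v : dot (- u) v = - dot u v.
Proof. by rewrite -scaleN1r dotZl mulN1r. Qed.

Lemma dotDr u v w : dot w (u + v) = dot w u + dot w v.
Proof. by rewrite dotC dotDl !(dotC w). Qed.

Lemma dotZr a u v : dot u (a *: v) = a * dot u v.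
Proof. by rewrite dotC dotZl dotC. Qed.

Lemma dotNr u v : dot u (- v) = - dot u v.
Proof. by rewrite dotC dotNl dotC. Qed.

Definition dotE := (dotDl, dotDr, dotNl, dotNr, dotZl, dotZr).

Lemma dot_mulmx k (l : 'rV[R]_k) (P : 'M[R]_(k, d)) v :
  dot (l *m P) v = \sum_(j < k) l ord0 j * dot (row j P) v.
Proof.
rewrite mulmx_sum_row /dot; under eq_bigr do rewrite summxE mulr_suml.
rewrite exchange_big; apply: eq_bigr => j _; rewrite mulr_sumr.
by apply: eq_bigr => i _; rewrite !mxE mulrA.
Qed.

Lemma dotvv_ge0 u : 0 <= dot u u.
Proof. by apply: sumr_ge0 => i _; rewrite -expr2 sqr_ge0. Qed.

Lemma dotvv_eq0 u : (dot u u == 0) = (u == 0).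
Proof.
apply/eqP/eqP => [u0|->]; last by rewrite /dot big1 // => i _; rewrite mxE mul0r.
apply/rowP => i; rewrite mxE; apply/eqP; rewrite -sqrf_eq0 expr2; apply/eqP.
by apply: (psumr_eq0P _ u0) => // j _; rewrite -expr2 sqr_ge0.
Qed.

Lemma dotvv_gt0 u : (0 < dot u u) = (u != 0).
Proof. by rewrite lt_def dotvv_ge0 andbT dotvv_eq0. Qed.

Lemma enorm_sqr u : enorm u ^+ 2 = dot u u.
Proof.
have E : \sum_(i < d) u ord0 i ^+ 2 = dot u u.
  by apply: eq_bigr => i _; rewrite expr2.
by rewrite /enorm E sqr_sqrtr ?dotvv_ge0.
Qed.

Lemma enorm_ge0 u : 0 <= enorm u.
Proof. exact: sqrtr_ge0. Qed.

Lemma enorm_le1 u : (enorm u <= 1) = (dot u u <= 1).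
Proof. by rewrite -enorm_sqr expr_le1 ?enorm_ge0. Qed.

Lemma enorm_eq1 u : enorm u = 1 <-> dot u u = 1.
Proof.
rewrite -enorm_sqr; split=> [->|/eqP]; rewrite ?expr1n//.
by rewrite sqrp_eq1 ?enorm_ge0// => /eqP.
Qed.

Lemma cauchy_schwarz u v : dot u v ^+ 2 <= dot u u * dot v v.
Proof.
have [->|u0] := eqVneq u 0.
  by rewrite -(scale0r (0 : 'rV_d)) !dotZl !mul0r expr0n.
(* The squared norm of this vector is [dot u u] times the gap in the claimed inequality. *)
have := dotvv_ge0 (dot u u *: v - dot u v *: u).
rewrite !dotE (dotC v u).
have := u0; rewrite -dotvv_gt0 => u_gt0 H.
rewrite -subr_ge0 -(pmulr_rge0 _ u_gt0); apply: le_trans H _.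
by rewrite le_eqVlt; apply/orP; left; apply/eqP; ring.
Qed.

Lemma dot_continuous (T : topologicalType) (f g : T -> 'rV[R]_d) :
  continuous f -> continuous g -> continuous (fun x => dot (f x) (g x)).
Proof.
move=> cf cg; apply: (continuous_big add_continuous) => i _ x.
have cE (h : T -> 'rV[R]_d) : continuous h ->
    {for x, continuous (fun y => h y ord0 i)}.
  move=> ch; apply: (@continuous_comp _ _ _ h (fun M : 'rV[R]_d => M ord0 i)).
    exact: ch.
  exact: coord_continuous.
by apply: continuousM; exact: cE.
Qed.

Lemma subr_cst_continuous (c : 'rV[R]_d) : continuous (fun x : 'rV[R]_d => x - c).
Proof.
move=> x; apply: (@cvgB _ _ _ (nbhs x) (nbhs_filter x)); first exact: cvg_id.
exact: cvg_cst.
Qed.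

(** [ball] is taken in the max norm; passing to the Euclidean norm costs the factor [d]. *)
Lemma ball_dot (x y : 'rV[R]_d) e :
  ball x e y -> dot (y - x) (y - x) <= d%:R * e ^+ 2.
Proof.
case=> e0 /(_ ord0) xy.
rewrite -[X in X%:R * _]card_ord mulr_natl -sumr_const; apply: ler_sum => i _.
have := xy i; rewrite !mxE /ball/= distrC => /ltW; rewrite -expr2 => H.
by rewrite -[leLHS]real_normK ?num_real// ler_pXn2r ?nnegrE// ltW.
Qed.

End Dot.

(** * Jung's theorem on the sphere *)

(** Barycentric weights: as [l] runs over the simplex, [l *m P] runs over the convex hull of the
    rows of [P]. *)
Definition simplex (R : realType) (k : nat) : set 'rV[R]_k :=
  [set l | (forall i, 0 <= l ord0 i) /\ \sum_(i < k) l ord0 i = 1].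

Lemma simplex_compact (R : realType) k : compact (@simplex R k).
Proof.
apply: (@subclosed_compact _ _
    [set l : 'rV[R]_k | forall i, `[0, 1]%classic (l ord0 i)]).
- have -> : @simplex R k =
      (\bigcap_i ((fun l : 'rV[R]_k => l ord0 i) @^-1` [set x | 0 <= x])) `&`
      ((fun l : 'rV[R]_k => \sum_(i < k) l ord0 i) @^-1` [set x | x = 1]).
    apply/seteqP; split=> l /= [l0 l1]; split=> // i; first by move=> _; exact: l0.
    exact: l0.
  apply: closedI.
    apply: closed_bigI => i _; apply: closed_comp; last exact: closed_ge.
    by move=> x _; exact: coord_continuous.
  apply: closed_comp; last exact: closed_eq.
  move=> x _; apply: (continuous_big add_continuous) => i _.
  exact: coord_continuous.
- by apply: (@rV_compact R _ (fun=> `[0, 1]%classic)) => _; exact: segment_compact.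
move=> l [l0 l1] i; rewrite /= in_itv/= l0 -l1 (bigD1 i)//= lerDl.
by apply: sumr_ge0 => j _; exact: l0.
Qed.

Lemma mulmxr_continuous (R : realType) k d (P : 'M[R]_(k, d)) :
  continuous (fun l : 'rV[R]_k => l *m P).
Proof.
have -> : (fun l : 'rV[R]_k => l *m P) = (fun l => \sum_i l ord0 i *: row i P).
  by apply/funext => l; exact: mulmx_sum_row.
apply: (continuous_big add_continuous) => i _ x.
apply: (@cvgZ _ _ _ (nbhs x) (nbhs_filter x)); [exact: coord_continuous|exact: cvg_cst].
Qed.

(** Take the point of the convex hull nearest to the origin: if some row violated the inequality, a
    short move toward that row would come closer. *)
Lemma exists_min_norm (R : realType) k d (P : 'M[R]_(k.+1, d)) :
  exists2 l, simplex l &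
    forall i, dot (l *m P) (l *m P) <= dot (row i P) (l *m P).
Proof.
have simplex_e i : simplex (delta_mx ord0 i : 'rV[R]_k.+1).
  split=> [j|]; first by rewrite mxE ler0n.
  rewrite (bigD1 i)//= big1 ?mxE ?eqxx ?addr0// => j /negPf ji.
  by rewrite mxE ji andbF.
have [l + lmin] : exists2 l, l \in @simplex R k.+1 & forall m, m \in @simplex R k.+1 ->
    dot (l *m P) (l *m P) <= dot (m *m P) (m *m P).
  apply: EVT_min_rV; first by exists (delta_mx ord0 ord0).
    exact: simplex_compact.
  apply: continuous_subspaceT.
  by apply: dot_continuous; exact: mulmxr_continuous.
rewrite inE => lS; exists l => // i; set c := l *m P in lmin *.
rewrite leNgt; apply/negP => lt_c.
pose N := dot (row i P - c) (row i P - c).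
pose g := dot c c - dot (row i P) c.
have N0 : 0 <= N by exact: dotvv_ge0.
have g0 : 0 < g by rewrite subr_gt0.
(* The move lowers the squared norm by [t * (2 * g - t * N)], so it suffices that [0 < t <= 1] and
   [t * N <= g]. *)
pose t := g / (N + g + 1).
have D0 : 0 < N + g + 1 by lra.
have t0 : 0 < t by rewrite divr_gt0.
have t1 : t <= 1 by rewrite ler_pdivrMr// mul1r; lra.
have tN : t * N <= g.
  by rewrite mulrAC ler_pdivrMr// ler_pM2l//; lra.
have lS' : l + t *: (delta_mx ord0 i - l) \in @simplex R k.+1.
  have [l0 l1] := lS; have [e0 e1] := simplex_e i.
  rewrite inE; split=> [j|].
    have -> : (l + t *: (delta_mx ord0 i - l)) ord0 j =
        (1 - t) * l ord0 j + t * (delta_mx ord0 i : 'rV[R]_k.+1) ord0 j.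
      by rewrite !mxE; ring.
    by rewrite addr_ge0// mulr_ge0//; lra.
  under eq_bigr do rewrite mxE [X in _ + X]mxE [X in _ * X]mxE [X in _ * (_ + X)]mxE.
  by rewrite big_split -mulr_sumr/= sumrB e1 l1 subrr mulr0 addr0.
have := lmin _ lS'.
have -> : (l + t *: (delta_mx ord0 i - l)) *m P = c + t *: (row i P - c).
  by rewrite mulmxDl -scalemxAl mulmxBl -rowE.
have -> : dot (c + t *: (row i P - c)) (c + t *: (row i P - c)) =
    dot c c - t * (g + g - t * N).
  by rewrite /g /N !dotE (dotC c (row i P)); ring.
have : 0 < t * (g + g - t * N) by rewrite mulr_gt0//; lra.
by lra.
Qed.

Definition carrier (R : realType) k (l : 'rV[R]_k) : {set 'I_k} :=
  [set i | 0 < l ord0 i]%SET.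

(** The [l]-average of the nonnegative differences between the two sides is zero, so every
    difference of positive weight vanishes. *)
Lemma min_norm_face (R : realType) k d (P : 'M[R]_(k, d)) l : simplex l ->
  (forall i, dot (l *m P) (l *m P) <= dot (row i P) (l *m P)) ->
  forall i, 0 < l ord0 i -> dot (row i P) (l *m P) = dot (l *m P) (l *m P).
Proof.
move=> [l0 l1] ge_c i li0; set c := l *m P.
have S0 : \sum_i l ord0 i * (dot (row i P) c - dot c c) = 0.
  under eq_bigr do rewrite mulrBr.
  by rewrite sumrB -dot_mulmx -mulr_suml l1 mul1r subrr.
have /(_ i isT)/eqP : forall j, true -> l ord0 j * (dot (row j P) c - dot c c) = 0.
  by apply: (psumr_eq0P _ S0) => j _; rewrite mulr_ge0// subr_ge0.
by rewrite mulf_eq0 gt_eqF//= subr_eq0 => /eqP.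
Qed.

(* A linear dependence among the rows in the carrier is an affine one, because
   these rows have the same nonzero inner product with l *m P: this saves one
   point over Caratheodory's theorem in dimension d. *)
Lemma shrink_support (R : realType) k d (P : 'M[R]_(k, d)) l : simplex l ->
  l *m P != 0 ->
  (forall i, dot (l *m P) (l *m P) <= dot (row i P) (l *m P)) ->
  (d < #|carrier l|)%N ->
  exists l', [/\ simplex l', l' *m P = l *m P &
    (#|carrier l'| < #|carrier l|)%N].
Proof.
move=> lS c0 ge_c; set S := carrier l => ltdS.
have [l0 l1] := lS.
(* The rows in the carrier outnumber the dimension, hence are dependent; [mu] is a dependence
   extended by zero to all indices. *)
pose f (a : 'I_#|S|) := enum_val a.
have : kermx (rowsub f P) != 0.
  rewrite kermx_eq0 /row_free neq_ltn; apply/orP; left.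
  exact: leq_ltn_trans (rank_leq_col _) ltdS.
case/rowV0Pn => v /sub_kermxP vP v0.
pose mu := v *m rowsub f 1%:M.
have muP : mu *m P = 0 by rewrite -mulmxA -rowsubE.
have muE i : mu ord0 i = \sum_a v ord0 a * (f a == i)%:R.
  by rewrite mxE; apply: eq_bigr => a _; rewrite !mxE.
clearbody mu.
have muN i : i \notin S -> mu ord0 i = 0.
  move=> iS; rewrite muE big1// => a _; case: eqP => [fi|]; last by rewrite mulr0.
  by move: iS; rewrite -fi enum_valP.
have mu_neq0 : exists i, mu ord0 i != 0.
  have /rV0Pn[a va] := v0; exists (f a); rewrite muE (bigD1 a)//= eqxx mulr1.
  rewrite big1 ?addr0// => b /negPf ba.
  by rewrite (inj_eq enum_val_inj) ba mulr0.
have c_gt0 : 0 < dot (l *m P) (l *m P) by rewrite dotvv_gt0.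
have sum_mu : \sum_i mu ord0 i = 0.
  apply: (mulIf (lt0r_neq0 c_gt0)); rewrite mul0r mulr_suml.
  transitivity (dot (mu *m P) (l *m P)); last first.
    by rewrite muP -(scale0r (0 : 'rV_d)) dotZl mul0r.
  rewrite [RHS]dot_mulmx; apply: eq_bigr => i _.
  have [iS|/muN->] := boolP (i \in S); last by rewrite !mul0r.
  by rewrite (min_norm_face lS)//; move: iS; rewrite inE.
have [i0 mui0] : exists i, 0 < mu ord0 i.
  apply: contrapT => /forallNP mu_le0.
  have [i] := mu_neq0; apply/negP; rewrite negbK -oppr_eq0; apply/eqP.
  have : \sum_i - mu ord0 i = 0 by rewrite sumrN sum_mu oppr0.
  move/psumr_eq0P; apply=> // j _; rewrite oppr_ge0 leNgt; apply/negP; exact: mu_le0.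
have [i1 mui1 i1min] := @arg_minP _ R _ i0 (fun i => 0 < mu ord0 i)
  (fun i => l ord0 i / mu ord0 i) mui0.
(* The largest step along [- mu] that keeps all weights nonnegative; the weight at [i1] drops to
   zero. *)
pose t := l ord0 i1 / mu ord0 i1.
have t0 : 0 <= t by rewrite divr_ge0// ltW.
have i1S : i1 \in S by apply: contraTT mui1 => /muN->; rewrite ltxx.
exists (l - t *: mu); split.
- split=> [i|]; last first.
    under eq_bigr do rewrite !mxE.
    by rewrite sumrB l1 -mulr_sumr sum_mu mulr0 subr0.
  rewrite !mxE subr_ge0; have [mui|mui] := ltP 0 (mu ord0 i).
    by rewrite -ler_pdivlMr//; exact: i1min.
  by apply: le_trans (l0 i); rewrite mulr_ge0_le0.
- by rewrite mulmxBl -scalemxAl muP scaler0 subr0.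
apply: proper_card; apply/properP; split.
  apply/fintype.subsetP => i; rewrite !inE !mxE; apply: contraTT => iS.
  by rewrite muN ?inE// mulr0 subr0.
exists i1 => //; rewrite inE !mxE divfK ?subrr ?ltxx//.
by rewrite gt_eqF.
Qed.

(** Shrinking the carrier keeps the point [l *m P], hence also the hypotheses on it, so it can be
    iterated. *)
Lemma caratheodory_face (R : realType) k d (P : 'M[R]_(k, d)) l : simplex l ->
  l *m P != 0 ->
  (forall i, dot (l *m P) (l *m P) <= dot (row i P) (l *m P)) ->
  exists l', [/\ simplex l', l' *m P = l *m P &
    (#|carrier l'| <= d)%N].
Proof.
have [m] := ubnP #|carrier l|.
elim: m l => // m IH l lem lS c0 ge_c.
have [|ltd] := leqP #|carrier l| d; first by exists l.
have [l1 [l1S l1P l1lt]] := shrink_support lS c0 ge_c ltd.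
rewrite -l1P; apply: IH => //; rewrite ?l1P//.
by rewrite (leq_trans l1lt).
Qed.

(* The left-hand side is the l-average of the squared distances to row i, in which
   the term of row i itself vanishes. *)
Lemma min_norm_diameter (R : realType) k d (P : 'M[R]_(k, d)) (l : 'rV[R]_k) (D2 : R) :
  (forall i, dot (row i P) (row i P) = 1) ->
  (forall i j, dot (row i P - row j P) (row i P - row j P) <= D2) ->
  simplex l ->
  (forall i, dot (l *m P) (l *m P) <= dot (row i P) (l *m P)) ->
  forall i, 0 < l ord0 i ->
    2 * (1 - dot (l *m P) (l *m P)) <= D2 * (1 - l ord0 i).
Proof.
move=> P1 PD lS ge_c i li0; have [l0 l1] := lS; set c := l *m P.
have -> : 2 * (1 - dot c c) =
    \sum_j l ord0 j * dot (row j P - row i P) (row j P - row i P).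
  transitivity (\sum_j (2 * l ord0 j - 2 * (l ord0 j * dot (row j P) (row i P)))).
    rewrite sumrB -!mulr_sumr l1 -dot_mulmx dotC (min_norm_face lS)//.
    by rewrite mulr1 mulrBr mulr1.
  apply: eq_bigr => j _; rewrite !dotE !P1 (dotC (row i P)); ring.
rewrite (bigD1 i)//= subrr -(scale0r (0 : 'rV_d)) dotZl mul0r mulr0 add0r.
have -> : 1 - l ord0 i = \sum_(j < k | j != i) l ord0 j.
  by apply/eqP; rewrite subr_eq addrC -l1 (bigD1 i).
rewrite mulrC mulr_suml; apply: ler_sum => j _.
by rewrite ler_wpM2l.
Qed.

(* Jung's theorem on the unit sphere: the direction of the point nearest to the
   origin in the convex hull is the centre of the cap. *)
Lemma jung_cap (R : realType) k d (P : 'M[R]_(k.+1, d)) (D2 : R) :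
  (forall i, dot (row i P) (row i P) = 1) ->
  (forall i j, dot (row i P - row j P) (row i P - row j P) <= D2) ->
  D2 <= 2 ->
  exists2 c : 'rV[R]_d, dot c c = 1 &
    forall i, 0 < dot (row i P) c /\
      D2 <= d%:R * (D2 - 2 * (1 - dot (row i P) c ^+ 2)).
Proof.
move=> P1 PD D2le2.
have D2ge0 : 0 <= D2 by apply: le_trans (PD ord0 ord0); exact: dotvv_ge0.
have [l lS ge_c] := exists_min_norm P.
have boundS := min_norm_diameter P1 PD.
have carrier_neq0 m : @simplex R k.+1 m -> exists i, 0 < m ord0 i.
  move=> [m0 m1]; apply: contrapT => /forallNP m_le0.
  have : \sum_i m ord0 i = 0.
    by rewrite big1// => i _; apply/le_anti; rewrite m0 andbT leNgt; apply/negP.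
  by rewrite m1 => /eqP; rewrite oner_eq0.
(* As [D2 <= 2], the diameter bound at an index of positive weight gives [l ord0 i <= dot c c] for
   the nearest point [c]. *)
have c_gt0 : 0 < dot (l *m P) (l *m P).
  have [i li] := carrier_neq0 _ lS.
  have := boundS _ lS ge_c i li.
  have li1 : l ord0 i <= 1.
    case: lS => l0 <-; rewrite (bigD1 i)//= lerDl.
    by apply: sumr_ge0 => j _; exact: l0.
  have : D2 * (1 - l ord0 i) <= 2 * (1 - l ord0 i) by rewrite ler_wpM2r// subr_ge0.
  lra.
have [l' [l'S l'P card_l']] : exists l', [/\ simplex l', l' *m P = l *m P &
    (#|carrier l'| <= d)%N].
  by apply: caratheodory_face => //; rewrite -dotvv_gt0.
rewrite -l'P in ge_c c_gt0; set c0 := l' *m P in ge_c c_gt0.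
have {}boundS := boundS _ l'S ge_c; rewrite -/c0 in boundS.
have gap_ge0 : 0 <= D2 - 2 * (1 - dot c0 c0).
  have [i li] := carrier_neq0 _ l'S.
  have := boundS i li.
  have : 0 <= D2 * l' ord0 i by rewrite mulr_ge0// ltW.
  lra.
(* Sum the bounds [D2 * l' ord0 i <= D2 - 2 * (1 - dot c0 c0)] over the at most [d] carrier indices,
   whose weights add up to 1. The result is Jung's bound: [1 - dot c0 c0] is at most
   [D2 * (d - 1) / (2 * d)]. *)
have gap_ge : D2 <= d%:R * (D2 - 2 * (1 - dot c0 c0)).
  apply: (@le_trans _ _ (#|carrier l'|%:R * (D2 - 2 * (1 - dot c0 c0)))); last first.
    by rewrite ler_wpM2r// ler_nat.
  rewrite mulr_natl -sumr_const.
  have {1}-> : D2 = \sum_(i in carrier l') D2 * l' ord0 i.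
    have [l'0 l'1] := l'S.
    rewrite -mulr_sumr -{1}[D2]mulr1 -l'1; congr (_ * _).
    rewrite (bigID (mem (carrier l')))/= [X in _ + X]big1 ?addr0// => i.
    by rewrite inE -leNgt => li; apply/le_anti; rewrite li l'0.
  apply: ler_sum => i; rewrite inE => li.
  by have := boundS i li; lra.
pose s := Num.sqrt (dot c0 c0).
have s0 : 0 < s by rewrite sqrtr_gt0.
have sE : dot c0 c0 = s ^+ 2 by rewrite sqr_sqrtr// ltW.
have h_ge i : s <= dot (row i P) (s^-1 *: c0).
  by rewrite dotZr mulrC ler_pdivlMr// -expr2 -sE.
exists (s^-1 *: c0).
  by rewrite !dotE sE expr2 mulKf ?mulVf// gt_eqF.
move=> i; split; first exact: lt_le_trans (h_ge i).
apply: le_trans gap_ge _; rewrite ler_wpM2l ?ler0n//.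
rewrite sE; have : s ^+ 2 <= dot (row i P) (s^-1 *: c0) ^+ 2.
  by rewrite ler_pXn2r// nnegrE ltW// (lt_le_trans s0).
lra.
Qed.

(** * Illumination of ball bodies *)

(** The acute angles from [c] to [u] and to [v] add up to less than a right angle. Cauchy-Schwarz is
    applied to the components orthogonal to [c]. *)
Lemma dot_gt0_of_caps (R : realType) d (c u v : 'rV[R]_d) :
  dot c c = 1 -> dot u u = 1 -> dot v v = 1 ->
  0 < dot u c -> 0 < dot v c -> 1 < dot u c ^+ 2 + dot v c ^+ 2 ->
  0 < dot u v.
Proof.
move=> c1 u1 v1 a0 h0 sum_gt1.
have := cauchy_schwarz (u - dot u c *: c) (v - dot v c *: c).
set a := dot u c in a0 sum_gt1 *; set h := dot v c in h0 sum_gt1 *.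
have -> : dot (u - a *: c) (v - h *: c) = dot u v - a * h.
  by rewrite !dotE (dotC c v) -/a -/h c1; ring.
have -> : dot (u - a *: c) (u - a *: c) = 1 - a ^+ 2.
  by rewrite !dotE (dotC c u) -/a c1 u1; ring.
have -> : dot (v - h *: c) (v - h *: c) = 1 - h ^+ 2.
  by rewrite !dotE (dotC c v) -/h c1 v1; ring.
move=> CS; rewrite ltNge; apply/negP => uv_le0.
have ah0 : 0 < a * h by rewrite mulr_gt0.
have : (a * h) ^+ 2 <= (dot u v - a * h) ^+ 2.
  by rewrite -[leRHS]sqrrN ler_pXn2r// ?nnegrE; lra.
have : (1 - a ^+ 2) * (1 - h ^+ 2) - (a * h) ^+ 2 = 1 - (a ^+ 2 + h ^+ 2) by ring.
lra.
Qed.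

(** Each centre [x] either is approached when moving along [v] or lies at distance less than 1 from
    [b]. Compactness of [X] makes this alternative uniform, so one short step enters all balls with
    a common margin. *)
Lemma illuminates_of_dot_gt0 (R : realType) d (X : set 'rV[R]_d) (b v : 'rV[R]_d) :
  compact X -> X !=set0 -> ball_body X b -> dot v v = 1 ->
  (forall x, X x -> dot (b - x) (b - x) = 1 -> 0 < dot v (x - b)) ->
  illuminates (ball_body X) v b.
Proof.
move=> cX X0 bX v1 vX.
have bX1 x : X x -> dot (b - x) (b - x) <= 1.
  by move=> /bX; rewrite /unit_ball/= enorm_le1.
pose g (x : 'rV[R]_d) := Num.max (dot v (x - b)) (1 - dot (x - b) (x - b)).
have gc : continuous g.
  have cb := @subr_cst_continuous R d b.
  have c1 : continuous (fun x : 'rV[R]_d => dot v (x - b)).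
    exact: (dot_continuous (@cst_continuous _ _ v) cb).
  have c2 : continuous (fun x : 'rV[R]_d => dot (x - b) (x - b)) by exact: dot_continuous.
  apply: (max_fun_continuous c1) => x.
  by apply: (@cvgB _ _ _ (nbhs x) (nbhs_filter x)); [exact: cvg_cst|exact: c2].
have [x0 + x0min] := EVT_min_rV X0 cX (continuous_subspaceT gc).
rewrite inE => Xx0; set m := g x0 in x0min.
have dotBC x y : dot (x - y) (x - y) = dot (y - x) (y - x) :> R.
  by rewrite !dotE (dotC y x); ring.
have m0 : 0 < m.
  rewrite /m /g lt_max; have := bX1 _ Xx0; rewrite le_eqVlt => /orP[/eqP|] H.
    by rewrite vX.
  by rewrite dotBC subr_gt0 H orbT.
(* With [6 * t] below both 1 and [m], either case of the alternative leaves the margin [t ^+ 2] in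
   [slack]. *)
pose t := Num.min 1 m / 6.
have [t0 t6 tm] : [/\ 0 < t, 6 * t <= 1 & 6 * t <= m].
  rewrite /t; split; first by rewrite divr_gt0// lt_min ltr01.
    by rewrite mulrC divfK// ge_min lexx.
  by rewrite mulrC divfK// ge_min lexx orbT.
have slack x : X x -> dot (b + t *: v - x) (b + t *: v - x) <= 1 - t ^+ 2.
  move=> Xx; have bx1 := bX1 _ Xx.
  have -> : dot (b + t *: v - x) (b + t *: v - x) =
      dot (b - x) (b - x) - 2 * (t * dot v (x - b)) + t ^+ 2.
    by rewrite !dotE v1 (dotC x b) (dotC b v) (dotC x v); ring.
  have t2 : t ^+ 2 <= t by rewrite expr2 ger_pMl//; lra.
  have := x0min x; rewrite inE => /(_ Xx); rewrite /g le_max => /orP[H|H].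
    have : t * (6 * t) <= t * dot v (x - b) by rewrite ler_pM2l//; lra.
    have : t * (6 * t) = 6 * t ^+ 2 by ring.
    have := sqr_ge0 t; lra.
  have := cauchy_schwarz v (x - b); rewrite v1 mul1r dotBC => CS.
  have : - 1 <= dot v (x - b).
    rewrite leNgt; apply/negP => lt1.
    have : 1 < dot v (x - b) ^+ 2.
      by rewrite -sqrrN expr_gt1//; lra.
    by move=> ?; lra.
  rewrite -(ler_pM2l t0) mulrN1 => ?; rewrite dotBC in H; lra.
exists t; first exact: ltW.
(* This radius makes the Euclidean norm of [z] at most [t ^+ 2 / 4]; the cross term and the square
   then use at most three quarters of the margin. *)
pose e := t ^+ 2 / (4 * (d%:R + 1)).
have d0 : 0 <= d%:R :> R by exact: ler0n.
have e0 : 0 < e by rewrite divr_gt0 ?exprn_gt0//; lra.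
have eE : t ^+ 2 / 4 = (d%:R + 1) * e by rewrite /e; field; lra.
clearbody e; apply/nbhs_ballP; exists e => //= y /ball_dot.
set q := b + t *: v; set z := y - q => ze x Xx.
rewrite /unit_ball/= enorm_le1.
have -> : y - x = (q - x) + z by rewrite /z [RHS]addrC addrA subrK.
have t2 : t ^+ 2 <= 1 by rewrite expr_le1//; lra.
have t2_gt0 : 0 < t ^+ 2 by rewrite exprn_gt0.
have zz : dot z z <= (t ^+ 2 / 4) ^+ 2.
  apply: le_trans ze _.
  rewrite eE exprMn; apply: ler_wpM2r; first exact: sqr_ge0.
  by have := sqr_ge0 (d%:R : R); rewrite sqrrD; lra.
have zz1 : (t ^+ 2 / 4) ^+ 2 <= t ^+ 2 / 4 by rewrite [leLHS]expr2 ger_pMl//; lra.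
have qz : dot (q - x) z <= t ^+ 2 / 4.
  rewrite leNgt; apply/negP => lt1.
  have := cauchy_schwarz (q - x) z.
  have : dot (q - x) (q - x) * dot z z <= dot z z.
    by apply: ler_piMl; [exact: dotvv_ge0|have := slack _ Xx; rewrite -/q; lra].
  have : (t ^+ 2 / 4) ^+ 2 < dot (q - x) z ^+ 2.
    by rewrite ltr_pXn2r// nnegrE; lra.
  lra.
have := slack _ Xx; rewrite -/q => ?.
rewrite dotDl !(dotDr (q - x) z) (dotC z (q - x)); lra.
Qed.

Lemma ball_body_closed (R : realType) d (X : set 'rV[R]_d) : closed (ball_body X).
Proof.
apply: closed_bigI => x _.
have -> : unit_ball x = (fun y => dot (y - x) (y - x)) @^-1` [set r | r <= 1].
  by apply/seteqP; split=> y; rewrite /unit_ball/= enorm_le1.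
apply: closed_comp; last exact: closed_le.
by move=> y _; apply: dot_continuous; exact: subr_cst_continuous.
Qed.

Lemma ball_body_compact (R : realType) d (X : set 'rV[R]_d) :
  X !=set0 -> compact (ball_body X).
Proof.
move=> [x Xx]; apply: subclosed_compact (@ball_body_closed _ _ X) _ _.
  apply: (@rV_compact R d (fun i => `[x ord0 i - 1, x ord0 i + 1]%classic)) => i.
  exact: segment_compact.
move=> y /(_ x Xx); rewrite /unit_ball/= enorm_le1 => yx i.
have : (y - x) ord0 i ^+ 2 <= 1.
  apply: le_trans yx; rewrite /dot (bigD1 i)//= expr2 lerDl.
  by apply: sumr_ge0 => j _; rewrite -expr2 sqr_ge0.
rewrite -[leLHS]real_normK ?num_real// expr_le1// ler_norml !mxE in_itv/= => /andP[? ?].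
by apply/andP; split; lra.
Qed.

(** For [0 < d], the condition [d%:R * (D2 - 2 * r ^+ 2) <= D2] says that [r] is at least Jung's
    bound on the sine of the cap radius. *)
Lemma illuminated_by_cover (R : realType) d (X : set 'rV[R]_d) (D2 r : R) n
    (v : 'I_n.+1 -> 'rV[R]_d) :
  compact X -> X !=set0 ->
  (forall x y, X x -> X y -> dot (x - y) (x - y) <= D2) -> D2 <= 2 ->
  0 <= r -> d%:R * (D2 - 2 * r ^+ 2) <= D2 ->
  (forall i, dot (v i) (v i) = 1) ->
  (forall c, dot c c = 1 -> exists i, r < dot (v i) c) ->
  illuminated_by (ball_body X) n.+1.
Proof.
move=> cX X0 XD D2le2 r0 Dr v1 cover; exists v => [i|b [bK _]].
  by rewrite /unit_sphere/= enorm_eq1.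
have {}bK : ball_body X b by exact: ball_body_closed.
apply: contrapT => /forallNP not_ill.
have ex i : exists x, [/\ X x, dot (b - x) (b - x) = 1 & dot (v i) (x - b) <= 0].
  apply: contrapT => /forallNP no_x; apply: (not_ill i).
  apply: illuminates_of_dot_gt0 => // x Xx x1.
  by rewrite ltNge; apply/negP => H; apply: (no_x x).
have [x xP] := choice ex.
pose P : 'M[R]_(n.+1, d) := \matrix_i (x i - b).
have PE i : row i P = x i - b by rewrite rowK.
have P1 i : dot (row i P) (row i P) = 1.
  by rewrite PE; have [_ <- _] := xP i; rewrite !dotE (dotC b (x i)); ring.
have PD i j : dot (row i P - row j P) (row i P - row j P) <= D2.
  rewrite !PE opprB addrA subrK.
  by have [Xi _ _] := xP i; have [Xj _ _] := xP j; exact: XD.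
have [c c1 Pc] := jung_cap P1 PD D2le2.
have [i rc] := cover c c1.
have [Pc0 capP] := Pc i.
have [_ _] := xP i; rewrite -PE leNgt => /negP; apply.
apply: (dot_gt0_of_caps c1) => //; first exact: le_lt_trans rc.
have d0 : 0 < d%:R :> R.
  rewrite ltr0n lt0n; apply/eqP => d0.
  have := c1; rewrite /dot big1 => [/eqP|j _]; first by rewrite eq_sym oner_eq0.
  by exfalso; move: j; rewrite d0 => -[].
have : r ^+ 2 < dot (v i) c ^+ 2 by rewrite ltr_pXn2r// nnegrE ltW// (le_lt_trans r0).
have : D2 - 2 * r ^+ 2 <= D2 - 2 * (1 - dot (row i P) c ^+ 2).
  by rewrite -(ler_pM2l d0); exact: le_trans capP.
lra.
Qed.

(** From an interior point a short step along [w] stays in [K] and strictly increases the inner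
    product with [w]. *)
Lemma interior_dot_lt (R : realType) d (K : set 'rV[R]_d) (w y : 'rV[R]_d) (M : R) :
  w != 0 -> (forall x, K x -> dot w x <= M) -> K° y -> dot w y < M.
Proof.
move=> w0 KM /nbhs_ballP[e /= e0 eK].
pose s := e / (1 + `|w|).
have w_ge0 : 0 <= `|w| by [].
have s0 : 0 < s by rewrite divr_gt0//; lra.
have : K (y + s *: w).
  apply: eK; rewrite -ball_normE/= opprD addNKr normrN normrZ gtr0_norm//.
  by rewrite /s mulrAC ltr_pdivrMr ?ltr_pM2l//; lra.
move/KM; rewrite dotDr dotZr; apply: lt_le_trans; rewrite ltrDl mulr_gt0//.
by rewrite dotvv_gt0.
Qed.

(** If the [v i] do not span, take [w] orthogonal to all of them. Otherwise [n = d], they form a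
    basis, and [dot w (v i) = 1] can be solved for all [i]. *)
Lemma exists_nonneg_dot (R : realType) d n (v : 'I_n -> 'rV[R]_d) :
  (0 < d)%N -> (n <= d)%N ->
  exists2 w : 'rV[R]_d, w != 0 & forall i, 0 <= dot w (v i).
Proof.
move=> d0 led; pose V : 'M[R]_(n, d) := \matrix_i v i.
have VE (w : 'rV[R]_d) i : dot w (v i) = (w *m V^T) ord0 i.
  by rewrite mxE; apply: eq_bigr => j _; rewrite !mxE.
have [Vfree|] := boolP (row_free V^T); last first.
  rewrite -kermx_eq0 => /rowV0Pn[w /sub_kermxP wV w0]; exists w => // i.
  by rewrite VE wV mxE.
have nd : n = d.
  apply/eqP; rewrite eqn_leq led/=.
  by move: Vfree; rewrite /row_free => /eqP <-; exact: rank_leq_col.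
have Vfull : row_full V^T.
  by move: Vfree; rewrite /row_free /row_full => /eqP->; rewrite nd.
have /submxP[w wV] := submx_full (const_mx 1 : 'rV[R]_n) Vfull.
exists w => [|i]; last by rewrite VE -wV mxE ler01.
have n0 : (0 < n)%N by rewrite nd.
apply/eqP => w0; move: wV; rewrite w0 mul0mx => /rowP/(_ (Ordinal n0))/eqP.
by rewrite !mxE oner_eq0.
Qed.

Lemma illuminated_by_gt_dim (R : realType) d (K : set 'rV[R]_d) n :
  (0 < d)%N -> compact K -> K° !=set0 -> illuminated_by K n -> (d < n)%N.
Proof.
move=> d0 cK [y yK] [v _ vK]; rewrite ltnNge; apply/negP => led.
have [w w0 wv] := exists_nonneg_dot v d0 led.
have cw : continuous (fun x : 'rV[R]_d => dot w x).
  apply: (dot_continuous (@cst_continuous _ _ w)) => x; exact: cvg_id.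
have [b + bmax] : exists2 b, b \in K & forall x, x \in K -> dot w x <= dot w b.
  apply: EVT_max_rV => //; first by exists y; exact: interior_subset.
  exact: continuous_subspaceT.
rewrite inE => bK.
have Kle x : K x -> dot w x <= dot w b by move=> Kx; apply: bmax; rewrite inE.
have [|i [t t0 /(interior_dot_lt w0 Kle)]] := vK b.
  by split; [exact: subset_closure|move=> /(interior_dot_lt w0 Kle); rewrite ltxx].
by rewrite dotDr dotZr gtrDl ltNge mulr_ge0.
Qed.

(** [sup] takes the default value 0 on sets without a supremum, so a positive value certifies a
    genuine one. *)
Lemma diam_gt0 (R : realType) d (X : set 'rV[R]_d) : 0 < diam X ->
  X !=set0 /\ forall x y, X x -> X y -> enorm (x - y) <= diam X.
Proof.
move=> D0; have hs : has_sup [set enorm (p.1 - p.2) | p in X `*` X].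
  by apply: contrapT => /sup_out E; move: D0; rewrite /diam E ltxx.
split; first by have [[_ [[x y] [/= Xx _] _]] _] := hs; exists x.
by move=> x y Xx Xy; apply: sup_upper_bound hs _ _; exists (x, y).
Qed.

(** * Coverings of the sphere by caps *)

(** Zero sum forces every [a i] into the interval from [- n * m] to [m]. Summing the products
    [(m - a i) * (a i + n * m) >= 0] cancels the linear terms. *)
Lemma sum_sqr_le_of_sum0 (R : realType) n (a : 'I_n.+1 -> R) (m : R) :
  \sum_i a i = 0 -> (forall i, a i <= m) ->
  \sum_i a i ^+ 2 <= n.+1%:R * (n%:R * m ^+ 2).
Proof.
move=> a0 am.
have : 0 <= \sum_i (m - a i) * (a i + n%:R * m).
  apply: sumr_ge0 => i _; apply: mulr_ge0; first by rewrite subr_ge0.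
  have : \sum_(j < n.+1 | j != i) a j <= n%:R * m.
    rewrite mulr_natl -[n in X in _ <= X](_ : #|predC1 i| = n); last first.
      by rewrite cardC1 card_ord.
    by rewrite -sumr_const; apply: ler_sum => j _.
  by move: a0; rewrite (bigD1 i)//=; lra.
have E i : (m - a i) * (a i + n%:R * m) =
    n%:R * m ^+ 2 - (n%:R - 1) * m * a i - a i ^+ 2 by ring.
under eq_bigr do rewrite E.
rewrite !sumrB sumr_const card_ord -mulr_sumr a0 mulr0 subr0 subr_ge0.
by rewrite (mulr_natl (n%:R * _)).
Qed.

(** In the cyclic group ['I_3] the index [-1] is the last one, 2. *)
Lemma dot3E (R : realType) (u v : 'rV[R]_3) : dot u v =
  u ord0 0 * v ord0 0 + u ord0 1 * v ord0 1 + u ord0 (-1) * v ord0 (-1).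
Proof.
have e1 : lift ord0 ord0 = 1 :> 'I_3 by exact/val_inj.
have e2 : lift ord0 (lift ord0 ord0) = -1 :> 'I_3 by exact/val_inj.
by rewrite /dot !big_ord_recl big_ord0 addr0 addrA e2 e1.
Qed.

(* 0.577 / sqrt 3 < 0.3332 < 1 / 3. *)
Lemma tetrahedron_cover (R : realType) : exists2 v : 'I_4 -> 'rV[R]_3,
  (forall i, dot (v i) (v i) = 1) &
  (forall c, dot c c = 1 -> exists i, 3332%:R / 10000%:R < dot (v i) c).
Proof.
pose s : R := Num.sqrt 3.
have s2 : s ^+ 2 = 3 by rewrite sqr_sqrtr.
have s0 : 0 < s by rewrite sqrtr_gt0.
(* Alternate vertices of the cube with coordinates 1 and -1: [u 0] is all ones, [u j.+1] has its
   only 1 in coordinate [j]. *)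
pose u (i : 'I_4) : 'rV[R]_3 :=
  \row_j (if (i == 0 :> nat) || (i == j.+1 :> nat) then 1 else -1).
have uu i : dot (u i) (u i) = 3.
  by rewrite dot3E !mxE; case: i => -[|[|[|[|//]]]] ? /=; ring.
exists (fun i => s^-1 *: u i) => [i|c c1]; first by rewrite !dotE uu -s2; field; lra.
apply: contrapT => /forallNP small.
have {}small i : dot (u i) c <= 3332%:R / 10000%:R * s.
  have := small i; rewrite dotZl [s^-1 * _]mulrC => /negP.
  by rewrite -leNgt ler_pdivrMr.
have u_sum : \sum_i dot (u i) c = 0.
  rewrite !big_ord_recl big_ord0 !dot3E !mxE /=; ring.
have u_sqr : \sum_i dot (u i) c ^+ 2 = 4 * dot c c.
  rewrite !big_ord_recl big_ord0 !dot3E !mxE /=; ring.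
(* This yields [4 <= 36 * 0.3332 ^+ 2], which is false. *)
have := sum_sqr_le_of_sum0 u_sum small.
rewrite u_sqr c1 exprMn s2; lra.
Qed.

(* 0.774 / sqrt 3 < 0.447 < 1 / sqrt 5. *)
Lemma bipyramid_cover (R : realType) : exists2 v : 'I_5 -> 'rV[R]_3,
  (forall i, dot (v i) (v i) = 1) &
  (forall c, dot c c = 1 -> exists i, 447%:R / 1000%:R < dot (v i) c).
Proof.
pose s : R := Num.sqrt 3 / 2.
have s2 : s ^+ 2 = 3 / 4 by rewrite expr_div_n sqr_sqrtr//; field.
clearbody s.
pose row3 (x y z : R) : 'rV[R]_3 := \row_j [:: x; y; z]`_j.
have row3E x y z c : dot (row3 x y z) c = x * c ord0 0 + y * c ord0 1 + z * c ord0 (-1).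
  by rewrite dot3E !mxE.
(* An equilateral triangle on the equator and the two poles. *)
pose v (i : 'I_5) := [:: row3 1 0 0; row3 (- 2^-1) s 0; row3 (- 2^-1) (- s) 0;
  row3 0 0 1; row3 0 0 (-1)]`_i.
exists v => [[[|[|[|[|[|//]]]]] ?]|c c1].
1-5: by rewrite /v/= row3E !mxE/=; lra.
apply: contrapT => /forallNP small.
have {}small i : dot (v i) c <= 447%:R / 1000%:R by rewrite leNgt; exact/negP.
pose a (i : 'I_3) := dot (v (widen_ord (isT : (3 <= 5)%N) i)) c.
have a_sum : \sum_i a i = 0.
  by rewrite !big_ord_recl big_ord0 /a /v /= !row3E; lra.
have a_sqr : \sum_i a i ^+ 2 = 3 / 2 * (c ord0 0 ^+ 2 + c ord0 1 ^+ 2).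
  rewrite !big_ord_recl big_ord0 /a /v /= !row3E.
  have := s2; set x := c _ _; set y := c _ _ => ?.
  transitivity (3 / 2 * x ^+ 2 + 2 * s ^+ 2 * y ^+ 2); first by field.
  by rewrite s2; field.
(* The triangle gives [x ^+ 2 + y ^+ 2 <= 4 * q ^+ 2] and the poles [z ^+ 2 <= q ^+ 2], so a unit
   vector would need [1 <= 5 * q ^+ 2]. *)
have := sum_sqr_le_of_sum0 a_sum (fun i => small _).
have := small (inord 3); have := small (inord 4).
rewrite /v !inordK// a_sqr /= !row3E.
move: c1; rewrite dot3E.
move: (c ord0 0) (c ord0 1) (c ord0 (-1)) => x y z xyz zl zu.
set q := 447%:R / 1000%:R in zl zu *.
have q2 : 5 * q ^+ 2 < 1 by rewrite /q; lra.
clearbody q; clear -xyz zl zu q2.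
have zq : 0 <= (q - z) * (q + z) by apply: mulr_ge0; lra.
lra.
Qed.

Lemma illumination_number_le (R : realType) d (K : set 'rV[R]_d) n :
  illuminated_by K n -> (illumination_number K <= n%:R%:E)%E.
Proof. by move=> Kn; apply: ereal_inf_lbound; exists n. Qed.

Theorem corollary1p2 (R : realType) (X : set 'rV[R]_3)
    (X_compact : compact X) (X_body : spindle_convex_body X) :
  (0 < diam X <= 577%:R / 1000%:R ->
     illumination_number (ball_body X) = (4%:R)%:E) /\
  (577%:R / 1000%:R < diam X <= 774%:R / 1000%:R ->
     (illumination_number (ball_body X) <= (5%:R)%:E)%E).
Proof.
have distX (D : R) : 0 < diam X -> diam X <= D ->
    X !=set0 /\ forall x y, X x -> X y -> dot (x - y) (x - y) <= D ^+ 2.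
  move=> X0 XD; have [Xn0 Xd] := diam_gt0 X0; split=> // x y Xx Xy.
  rewrite -enorm_sqr ler_pXn2r ?nnegrE ?enorm_ge0//; last lra.
  exact: le_trans (Xd _ _ Xx Xy) XD.
split=> /andP[D0 D1].
- have [X0 XD] := distX _ D0 D1.
  apply/le_anti/andP; split.
    have [v v1 cover] := tetrahedron_cover R.
    apply: illumination_number_le.
    (* In dimension 3 the condition on [r] reads [D2 <= 3 * r ^+ 2]; here
       [0.577 ^+ 2 <= 3 * 0.3332 ^+ 2]. *)
    by apply: (illuminated_by_cover X_compact X0 XD _ _ _ v1 cover); lra.
  apply: le_ereal_inf_tmp => _ [n Kn <-]; rewrite lee_fin ler_nat.
  exact: illuminated_by_gt_dim (ball_body_compact X0) X_body Kn.
- have [|X0 XD] := distX _ _ D1; first lra.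
  have [v v1 cover] := bipyramid_cover R.
  apply: illumination_number_le.
  by apply: (illuminated_by_cover X_compact X0 XD _ _ _ v1 cover); lra.
Qed.
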